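(* For every function $c=c(k)$, $$\lim_{k\to\infty}\sigma\big((k,c)\text{-Sparse-}\oplus\text{Set Cover}/n\big)\le\lim_{k'\to\infty}\sigma\big(k'\text{-}\oplus\text{Set Cover}/(n+t)\big).$$
   Context: $(k,c)$-Sparse-$\oplus$Set Cover: given $\mathcal F\subseteq 2^U$ with $|U|=n$, $|\mathcal F|\le c(k)\,n$, every set of size at most $k$, decide whether the number of $\mathcal C\subseteq\mathcal F$ with $\bigcup_{S\in\mathcal C}S=U$ is odd. $k'$-$\oplus$Set Cover: given an integer $t$ and $\mathcal F\subseteq 2^U$ with $|U|=n$, every set of size at most $k'$, decide whether the number of $\mathcal C\subseteq\mathcal F$ with $|\mathcal C|=t$ and $\bigcup_{S\in\mathcal C}S=U$ is odd. For a problem $\Pi$ with input size $m$ and a numerical parameter $p$ of the instance, $\sigma(\Pi/p)$ is the infimum of all $\epsilon>0$ such that $\Pi$ has a randomized algorithm with error probability at most $1/3$ running in time $2^{\epsilon p}\mathrm{poly}(m)$. *)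

(* Defs.v *)
From HB Require Import structures.
From mathcomp Require Import all_boot all_order all_algebra.
From mathcomp Require Import all_classical all_reals all_analysis.

Set Implicit Arguments.
Unset Strict Implicit.
Unset Printing Implicit Defensive.

Import Order.TTheory GRing.Theory Num.Theory.

Local Open Scope ring_scope.

(* Model of computation: the random access machine under the logarithmic cost
   criterion (Aho, Hopcroft, Ullman), with structured control flow and coin
   tosses.  A program has finitely many registers and an unbounded memory whose
   cells hold natural numbers and can be addressed indirectly. *)

Inductive binop := OpAdd | OpSub | OpMul | OpDiv.

Definition binop_sem (o : binop) : nat -> nat -> nat :=
  match o with
  | OpAdd => addn
  | OpSub => subn
  | OpMul => muln
  | OpDiv => divn
  end.

Inductive expr :=
  | Const of nat
  | Reg of nat
  | Fetch of expr
  | Bin of binop & expr & expr.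

Inductive cmd :=
  | Skip
  | Assign of nat & expr
  | Store of expr & expr
  | Toss of nat
  | Seq of cmd & cmd
  | If of expr & cmd & cmd
  | While of expr & cmd.

Record state := State { reg : nat -> nat; cell : nat -> nat }.

Definition upd (f : nat -> nat) (i v : nat) : nat -> nat :=
  fun j => if j == i then v else f j.

Definition set_reg (s : state) (i v : nat) : state :=
  State (upd (reg s) i v) (cell s).

Definition set_cell (s : state) (a v : nat) : state :=
  State (reg s) (upd (cell s) a v).

(* Binary length; bitlen 0 = 1. *)
Definition bitlen (a : nat) : nat := (trunc_log 2 a).+1.

Fixpoint eval_expr (s : state) (e : expr) : nat :=
  match e with
  | Const a => a
  | Reg i => reg s i
  | Fetch e1 => cell s (eval_expr s e1)
  | Bin o e1 e2 => binop_sem o (eval_expr s e1) (eval_expr s e2)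
  end.

(* Every intermediate value, in particular every operand of an arithmetic
   operation and every address, is charged its binary length. *)
Fixpoint expr_cost (s : state) (e : expr) : nat :=
  (bitlen (eval_expr s e) +
   match e with
   | Const _ | Reg _ => 0
   | Fetch e1 => expr_cost s e1
   | Bin _ e1 e2 => expr_cost s e1 + expr_cost s e2
   end)%N.

(* exec c s r T s' r': started in s with the random bits r still to be
   consumed, c halts in s' after time T, leaving the random bits r'.  A coin
   toss gets stuck when no random bits are left. *)
Inductive exec :
  cmd -> state -> seq bool -> nat -> state -> seq bool -> Prop :=
  | ExecSkip s r : exec Skip s r 1 s r
  | ExecAssign i e s r :
      exec (Assign i e) s r (expr_cost s e).+1 (set_reg s i (eval_expr s e)) r
  | ExecStore e1 e2 s r :
      exec (Store e1 e2) s r (expr_cost s e1 + expr_cost s e2).+1%N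
           (set_cell s (eval_expr s e1) (eval_expr s e2)) r
  | ExecToss i s b r : exec (Toss i) s (b :: r) 1 (set_reg s i b) r
  | ExecSeq c1 c2 s r T1 s1 r1 T2 s2 r2 :
      exec c1 s r T1 s1 r1 -> exec c2 s1 r1 T2 s2 r2 ->
      exec (Seq c1 c2) s r (T1 + T2)%N s2 r2
  | ExecIf e c1 c2 s r T s' r' :
      exec (if eval_expr s e != 0%N then c1 else c2) s r T s' r' ->
      exec (If e c1 c2) s r (expr_cost s e + T).+1%N s' r'
  | ExecWhileDone e c s r :
      eval_expr s e = 0%N -> exec (While e c) s r (expr_cost s e).+1 s r
  | ExecWhileLoop e c s r T1 s1 r1 T2 s2 r2 :
      eval_expr s e <> 0%N ->
      exec c s r T1 s1 r1 -> exec (While e c) s1 r1 T2 s2 r2 ->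
      exec (While e c) s r (expr_cost s e + T1 + T2).+1%N s2 r2.

(* The input word is in memory cells 0, 1, ...; all else is zero. *)
Definition init (w : seq nat) : state :=
  State (fun=> 0%N) (fun a => nth 0%N w a).

(* The answer is "yes" iff register 0 is nonzero at the end. *)
Definition halts_with (A : cmd) (w : seq nat) (r : seq bool) (T : nat)
    (b : bool) : Prop :=
  exists s' r', exec A (init w) r T s' r' /\ (reg s' 0 != 0%N) = b.

(* A decision problem: only the legal instances matter. *)
Record problem := Problem {
  instance_of :> Type;
  legal : instance_of -> Prop;
  encoding : instance_of -> seq nat;
  answer : instance_of -> bool
}.

Definition input_size (P : problem) (x : P) : nat :=
  (\sum_(a <- encoding x) bitlen a)%N.

(* A decides the instance x within time T: for some number l of fair random
   bits, A halts within time T on each of the 2 ^ l outcomes, and the fraction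
   of outcomes with a wrong answer is at most 1/3. *)
Definition decides_within (R : realType) (P : problem) (A : cmd) (x : P)
    (T : R) : Prop :=
  exists (l : nat) (out : l.-tuple bool -> bool),
    (forall r : l.-tuple bool,
       exists t : nat, halts_with A (encoding x) r t (out r) /\ t%:R <= T) /\
    #|[set r : l.-tuple bool | out r != answer x]|%:R / 2 ^+ l <= 1 / 3 :> R.

Definition sigma (R : realType) (P : problem) (p : P -> nat) : \bar R :=
  ereal_inf [set e%:E | e in [set e : R | 0 < e /\
    exists (A : cmd) (q : {poly nat}), forall x : P, legal x ->
      decides_within A x (2 `^ (e * (p x)%:R) * (q.[input_size x])%:R)]].

(* A family of subsets of a universe of size n, listed in an arbitrary order
   without repetition. *)
Record set_family := SetFamily {
  univ_size : nat;
  sets : seq {set 'I_univ_size};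
  sets_uniq : uniq sets
}.

Definition incidence (F : set_family) : seq nat :=
  flatten [seq [seq nat_of_bool (u \in X) | u <- enum 'I_(univ_size F)]
          | X : {set 'I_(univ_size F)} <- sets F].

Definition covers (F : set_family) : {set {set {set 'I_(univ_size F)}}} :=
  [set C : {set {set 'I_(univ_size F)}} |
    (C \subset sets F) && (\bigcup_(X in C) X == [set: 'I_(univ_size F)])].

Definition sets_bounded (k : nat) (F : set_family) : Prop :=
  forall X, X \in sets F -> (#|X| <= k)%N.

Definition sparse_parity_set_cover (R : realType) (k : nat) (ck : R) : problem :=
  {| instance_of := set_family;
     legal := fun F => sets_bounded k F /\
                (size (sets F))%:R <= ck * (univ_size F)%:R;
     encoding := fun F => [:: univ_size F, size (sets F) & incidence F];
     answer := fun F => odd #|covers F| |}.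

Definition parity_set_cover (k : nat) : problem :=
  {| instance_of := set_family * nat;
     legal := fun Ft => sets_bounded k Ft.1;
     encoding := fun Ft =>
       [:: univ_size Ft.1, Ft.2, size (sets Ft.1) & incidence Ft.1];
     answer := fun Ft => odd #|[set C in covers Ft.1 | #|C| == Ft.2]| |}.

Definition sigma_sparse (R : realType) (c : nat -> R) (k : nat) : \bar R :=
  @sigma R (sparse_parity_set_cover k (c k)) (fun F => univ_size F).

Definition sigma_parity (R : realType) (k : nat) : \bar R :=
  @sigma R (parity_set_cover k) (fun Ft => univ_size Ft.1 + Ft.2)%N.

(* Main.v *)
(* Split the sets of a sparse instance into groups of [p].  In the new instance
   a row is a subset of one group: it is the union of the chosen sets, together
   with an element naming the group, and [t] is the number of groups, so that a
   cover of size [t] takes exactly one row from each group.  Covers are thus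
   in bijection with the covers of the original instance, while [n + t] grows
   only to [(1 + 2 c / p) n + O(1)]; let [p] tend to infinity.  Two subsets of a
   group may have the same union: [p] label elements recording the chosen subset
   keep the rows distinct, and one extra group, with the single row containing
   all the labels, covers them.

   The random access machine rewrites the incidence matrix in place, from the
   last entry to the first: the entries it reads always precede the one it
   writes. *)
Require Import Defs.
From HB Require Import structures.
From mathcomp Require Import all_boot all_order all_algebra.
From mathcomp Require Import all_classical all_reals all_analysis.
From mathcomp Require Import zify ring lra.

Set Implicit Arguments.
Unset Strict Implicit.
Unset Printing Implicit Defensive.

Import Order.TTheory GRing.Theory Num.Theory.

(** * The reduced instance *)

Definition bit (i j : nat) : bool := odd (j %/ 2 ^ i).

Lemma bitS i j : bit i.+1 j = bit i (j %/ 2).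
Proof. by rewrite /bit expnS divnMA. Qed.

Lemma bit0 j : bit 0 j = odd j.
Proof. by rewrite /bit divn1. Qed.

Lemma bit_add_mul i p a s : i < p -> bit i (a * 2 ^ p + s) = bit i s.
Proof.
move=> ip; have -> : a * 2 ^ p = a * 2 ^ (p - i.+1) * 2 * 2 ^ i.
  by rewrite -!mulnA -expnS -expnD subnK.
by rewrite /bit divnMDl ?expn_gt0// oddD oddM andbF.
Qed.

Fixpoint of_bits (p : nat) (f : nat -> bool) : nat :=
  if p is q.+1 then f 0 + 2 * of_bits q (fun i => f i.+1) else 0.

Lemma of_bits_lt p f : of_bits p f < 2 ^ p.
Proof.
elim: p f => // p IH f /=; have := IH (fun i => f i.+1).
by rewrite expnS; case: (f 0) => /=; lia.
Qed.

Lemma bit_of_bits p f i : i < p -> bit i (of_bits p f) = f i.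
Proof.
elim: p f i => // p IH f [_|i ip] /=.
  by rewrite bit0 oddD mul2n odd_double addbF; case: (f 0).
rewrite bitS (_ : _ %/ 2 = of_bits p (fun i => f i.+1)) ?IH//.
by case: (f 0) => /=; lia.
Qed.

Lemma of_bits_ext p s f :
  s < 2 ^ p -> (forall i, i < p -> bit i s = f i) -> s = of_bits p f.
Proof.
elim: p s f => [|p IH] s f /=; first by rewrite expn0; lia.
rewrite expnS => sp sf; rewrite -(IH (s %/ 2)); last 2 first.
- by lia.
- by move=> i ip; rewrite -bitS sf.
rewrite -sf// bit0 {1}(divn_eq s 2) modn2; lia.
Qed.

(* The last group is the extra one, reduced to its row without chosen set. *)
Definition num_groups (p m : nat) : nat := m %/ p + 2.
Lemma num_groups_gt0 p m : 0 < num_groups p m.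
Proof. by rewrite /num_groups addn2. Qed.

Definition num_cols (p n m : nat) : nat := n + num_groups p m + p.
Definition num_rows (p m : nat) : nat := (num_groups p m).-1 * 2 ^ p + 1.

Section Entry.
Variables (p n m : nat) (inc : nat -> nat -> bool).
Local Notation H := (num_groups p m).
Local Notation ncol := (num_cols p n m).
Local Notation nrow := (num_rows p m).

Definition orig_part (j u : nat) : bool :=
  (u < n) && has (fun i => bit i j && inc (j %/ 2 ^ p * p + i) u) (iota 0 p).

(* A row choosing a set of index at least [m] lacks its group element; a cover
   by [H] rows, one for each group element, has no room for it. *)
Definition group_part (j u : nat) : bool :=
  (u == n + j %/ 2 ^ p) &&
  all (fun i => bit i j ==> (j %/ 2 ^ p * p + i < m)) (iota 0 p).

Definition label_part (j u : nat) : bool :=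
  has (fun i => (u == n + H + i) && (bit i j || (H <= (j %/ 2 ^ p).+1)))
    (iota 0 p).

Definition entry (j u : nat) : bool :=
  [|| orig_part j u, group_part j u | label_part j u].

Lemma row_group_lt j : j < nrow -> j %/ 2 ^ p < H.
Proof.
rewrite ltn_divLR ?expn_gt0// /num_rows /num_groups addn2 /= => jn.
by rewrite (leq_trans jn)// mulSn addnC leq_add2r expn_gt0.
Qed.

Lemma entry_orig j u : u < n -> entry j u = orig_part j u.
Proof.
move=> un; rewrite /entry.
have -> : group_part j u = false.
  by apply/negbTE; rewrite negb_and neq_ltn ltn_addr.
have -> : label_part j u = false; last by rewrite !orbF.
by apply/negbTE/hasPn => i _; rewrite negb_and; apply/orP; left; lia.
Qed.

Lemma entry_group j g : g < H -> entry j (n + g) = group_part j (n + g).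
Proof.
move=> gH; rewrite /entry /orig_part ltnNge leq_addr/=.
have -> : label_part j (n + g) = false; last by rewrite orbF.
by apply/negbTE/hasPn => i _; rewrite negb_and; apply/orP; left; lia.
Qed.

Lemma entry_label j i : j < nrow -> i < p ->
  entry j (n + H + i) = bit i j || (H <= (j %/ 2 ^ p).+1).
Proof.
move=> jn ip; have jH := row_group_lt jn.
rewrite /entry /orig_part ltnNge -addnA leq_addr/=.
have -> : group_part j (n + (H + i)) = false.
  by apply/negbTE; rewrite negb_and eqn_add2l neq_ltn ltn_addr ?orbT.
rewrite /label_part /=; apply/hasP/idP => [[i' _ /andP[/eqP e]]|h].
  by have -> : i' = i by lia.
by exists i; rewrite ?mem_iota//= addnA eqxx.
Qed.

End Entry.

Section Counting.
Variables (p n m : nat) (inc : nat -> nat -> bool).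
Hypothesis p_gt0 : 0 < p.
Local Notation H := (num_groups p m).
Local Notation ncol := (num_cols p n m).
Local Notation nrow := (num_rows p m).
Local Notation entry := (entry p n m inc).

Definition index_cover (k N : nat) (f : nat -> nat -> bool) (J : {set 'I_k}) :=
  [forall u : 'I_N, exists j in J, f j u].

Definition nat_mem (k : nat) (I : {set 'I_k}) (i : nat) : bool :=
  if insub i is Some x then x \in I else false.

Lemma nat_mem_lt k (I : {set 'I_k}) i : nat_mem I i -> i < k.
Proof. by rewrite /nat_mem; case: insubP. Qed.

Lemma nat_memE k (I : {set 'I_k}) (i : 'I_k) : nat_mem I i = (i \in I).
Proof. by rewrite /nat_mem valK. Qed.

Definition row_index (I : {set 'I_m}) (g : nat) : nat :=
  g * 2 ^ p + of_bits p (fun i => nat_mem I (g * p + i)).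

Lemma row_index_div I g : row_index I g %/ 2 ^ p = g.
Proof.
by rewrite /row_index divnMDl ?expn_gt0// divn_small ?addn0 ?of_bits_lt.
Qed.

Lemma bit_row_index I g i : i < p ->
  bit i (row_index I g) = nat_mem I (g * p + i).
Proof. by move=> ip; rewrite bit_add_mul// bit_of_bits. Qed.

Lemma last_group_ge i : m <= (num_groups p m).-1 * p + i.
Proof.
rewrite /num_groups addn2 /= (leq_trans _ (leq_addr _ _))//.
by rewrite mulSn addnC {1}(divn_eq m p) leq_add2l ltnW ?ltn_pmod.
Qed.

Lemma row_index_lt I (g : 'I_H) : row_index I g < nrow.
Proof.
have gH : g <= H.-1 by rewrite -ltnS prednK ?num_groups_gt0.
rewrite /num_rows addn1 ltnS /row_index.
have [gl|gl] := ltnP g H.-1.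
  apply: (@leq_trans (g.+1 * 2 ^ p)); last by rewrite leq_mul2r gl orbT.
  by rewrite mulSn addnC leq_add2r ltnW ?of_bits_lt.
have -> : nat_of_ord g = H.-1 by apply/eqP; rewrite eqn_leq gH gl.
rewrite -(@of_bits_ext p 0) ?addn0 ?expn_gt0// => i ip.
rewrite /bit div0n /=; apply/esym/negbTE/negP => /nat_mem_lt.
by rewrite ltnNge last_group_ge.
Qed.

Definition choice_row (I : {set 'I_m}) (g : 'I_H) : 'I_nrow :=
  Ordinal (row_index_lt I g).

Definition choice_set (I : {set 'I_m}) : {set 'I_nrow} :=
  [set choice_row I g | g : 'I_H].

Lemma div_group_lt i : i < m -> i %/ p < H.
Proof.
by move=> im; rewrite /num_groups addn2 ltnS leqW// leq_div2r// ltnW.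
Qed.

Lemma card_choice_set I : #|choice_set I| = H.
Proof.
rewrite card_imset ?card_ord// => g g' /(congr1 (fun x => val x %/ 2 ^ p)) /=.
by rewrite !row_index_div => /val_inj.
Qed.

Lemma choice_set_inj : injective choice_set.
Proof.
move=> I I' e; apply/setP => i; rewrite -!nat_memE.
pose g := Ordinal (div_group_lt (ltn_ord i)).
have : choice_row I g \in choice_set I' by rewrite -e imset_f.
case/imsetP => g' _ /(congr1 val) /= eg.
have gg' : nat_of_ord g = g'.
  by move/(congr1 (fun x => x %/ 2 ^ p)): eg; rewrite !row_index_div.
have ip : i %% p < p by rewrite ltn_pmod.
move/(congr1 (bit (i %% p))): eg; rewrite !bit_row_index// -gg'.
by rewrite /= -divn_eq.
Qed.

Lemma orig_part_choice_row I g (u : nat) : u < n ->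
  orig_part p n inc (choice_row I g) u =
  has (fun i => nat_mem I (g * p + i) && inc (g * p + i) u) (iota 0 p).
Proof.
move=> un; rewrite /orig_part un /= row_index_div; apply: eq_in_has => i.
by rewrite mem_iota /= => ip; rewrite bit_row_index.
Qed.

Lemma group_part_choice_row I (g : 'I_H) :
  group_part p n m (choice_row I g) (n + g).
Proof.
rewrite /group_part /= row_index_div eqxx; apply/allP => i.
rewrite mem_iota /= => ip; rewrite bit_row_index//.
by apply/implyP => /nat_mem_lt.
Qed.

Lemma cover_choice_set I :
  index_cover ncol entry (choice_set I) = index_cover n inc I.
Proof.
have n_ncol : n <= ncol by rewrite /num_cols -addnA leq_addr.
apply/forallP/forallP => cov u.
  have := cov (widen_ord n_ncol u).
  case/exists_inP => _ /imsetP[g _ ->].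
  rewrite entry_orig//= orig_part_choice_row// => /hasP[i _ /andP[mi iu]].
  have im := nat_mem_lt mi; apply/exists_inP; exists (Ordinal im) => //.
  by rewrite -nat_memE.
apply/exists_inP; have [un|nu] := ltnP u n.
  have /exists_inP[i iI iu] := cov (Ordinal un).
  pose g := Ordinal (div_group_lt (ltn_ord i)).
  exists (choice_row I g); first exact: imset_f.
  rewrite entry_orig// orig_part_choice_row//; apply/hasP; exists (i %% p).
    by rewrite mem_iota ltn_pmod.
  by rewrite -divn_eq nat_memE iI.
have [uH|Hu] := ltnP u (n + H).
  have [g ->] : exists g : 'I_H, nat_of_ord u = n + g.
    have uH' : u - n < H by lia.
    by exists (Ordinal uH'); rewrite /= subnKC.
  exists (choice_row I g); first exact: imset_f.
  by rewrite entry_group// group_part_choice_row.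
have gH : H.-1 < H by rewrite prednK ?num_groups_gt0.
exists (choice_row I (Ordinal gH)); first exact: imset_f.
have up : u - (n + H) < p by have := ltn_ord u; rewrite /num_cols; lia.
have -> : nat_of_ord u = n + H + (u - (n + H)) by lia.
rewrite (entry_label n inc (ltn_ord _) up) /= row_index_div.
by rewrite prednK ?num_groups_gt0// leqnn orbT.
Qed.

Lemma choice_set_surj (J : {set 'I_nrow}) :
  index_cover ncol entry J -> #|J| = H -> exists I, J = choice_set I.
Proof.
move=> /forallP cov cardJ.
have ex (g : 'I_H) : exists j, (j \in J) && group_part p n m j (n + g).
  have gc : n + g < ncol by have := ltn_ord g; rewrite /num_cols; lia.
  have /exists_inP[j jJ jg] := cov (Ordinal gc).
  by exists j; rewrite jJ -(@entry_group p n m inc).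
have [f fP] : exists f : 'I_H -> 'I_nrow,
    forall g, (f g \in J) && group_part p n m (f g) (n + g).
  by exists (fun g => xchoose (ex g)) => g; exact: xchooseP (ex g).
have fJ g : f g \in J by have /andP[] := fP g.
have fdiv g : f g %/ 2 ^ p = g.
  by have /andP[_ /andP[]] := fP g; rewrite eqn_add2l => /eqP ->.
have fval g i : i < p -> bit i (f g) -> g * p + i < m.
  move=> ip; have /andP[_ /andP[_ /allP/(_ i)]] := fP g.
  by rewrite mem_iota fdiv => /(_ ip)/implyP.
pose I := [set i : 'I_m | [exists g, (nat_of_ord g == i %/ p) &&
                                      bit (i %% p) (f g)]].
exists I; apply/esym/eqP; rewrite eqEcard card_choice_set cardJ leqnn andbT.
apply/fintype.subsetP => _ /imsetP[g _ ->].
rewrite (_ : choice_row I g = f g)//; apply: val_inj.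
rewrite /= /row_index [RHS](divn_eq _ (2 ^ p)) fdiv; congr (_ + _).
apply/esym/of_bits_ext; first by rewrite ltn_pmod ?expn_gt0.
move=> i ip; have <- : bit i (f g) = bit i (f g %% 2 ^ p).
  by rewrite [in LHS](divn_eq (f g) (2 ^ p)) bit_add_mul.
have dp : (g * p + i) %/ p = g by rewrite divnMDl// divn_small ?addn0.
have mp : (g * p + i) %% p = i by rewrite modnMDl modn_small.
apply/idP/idP => [b|].
  rewrite -[g * p + i]/(val (Ordinal (fval _ _ ip b))) nat_memE inE.
  by apply/existsP; exists g; rewrite /= dp mp eqxx.
move=> mem; have im := nat_mem_lt mem; move: mem.
rewrite -[g * p + i]/(val (Ordinal im)) nat_memE inE /= dp mp.
by move=> /existsP[g' /andP[/eqP/val_inj ->]].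
Qed.

Lemma card_index_covers :
  #|[set J : {set 'I_nrow} | index_cover ncol entry J && (#|J| == H)]| =
  #|[set I : {set 'I_m} | index_cover n inc I]|.
Proof.
rewrite -(card_imset _ choice_set_inj); congr #|pred_of_set _|.
apply/setP => J; rewrite inE; apply/andP/imsetP.
  move=> [cov /eqP/(choice_set_surj cov)[I e]]; exists I => //.
  by rewrite inE -cover_choice_set -e.
by move=> [I]; rewrite inE => cov ->; rewrite cover_choice_set card_choice_set.
Qed.

End Counting.

Lemma card_covers (F : set_family) (P : pred nat) (f : nat -> nat -> bool) :
  (forall (j : 'I_(size (sets F))) (u : 'I_(univ_size F)),
    f j u = (u \in nth finset.set0 (sets F) j)) ->
  #|[set C in covers F | P #|C| ]| =
  #|[set J : {set 'I_(size (sets F))} |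
      index_cover (univ_size F) f J && P #|J|]|.
Proof.
move=> fE; set k := size (sets F).
pose S (j : 'I_k) := nth finset.set0 (sets F) j.
have S_inj : injective S.
  move=> i j /eqP; rewrite nth_uniq ?sets_uniq// => /eqP; exact: val_inj.
have imS_inj : injective (fun J : {set 'I_k} => S @: J) by exact: imset_inj.
rewrite -(card_imset _ imS_inj); congr #|pred_of_set _|.
have cov (J : {set 'I_k}) : (\bigcup_(X in S @: J) X == finset.setT) =
             index_cover (univ_size F) f J.
  rewrite -finset.subTset big_imset /=; last by move=> ? ? _ _; exact: S_inj.
  apply/fintype.subsetP/forallP => c u.
    have /finset.bigcupP[j jJ uj] := c u (finset.in_setT _).
    by apply/exists_inP; exists j => //; rewrite fE.
  have /exists_inP[j jJ uj] := c u.
  by move=> _; apply/finset.bigcupP; exists j => //; rewrite -fE.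
apply/setP => C; rewrite !inE; apply/andP/imsetP.
  move=> [/andP[/fintype.subsetP CF covC] PC].
  have eC : C = S @: [set j | S j \in C].
    apply/setP => X; apply/idP/imsetP.
      move=> XC; have XF := CF _ XC.
      have iX : index X (sets F) < k by rewrite index_mem.
      by exists (Ordinal iX); rewrite ?inE /S /= nth_index.
    by move=> [j]; rewrite inE => ? ->.
  exists [set j | S j \in C] => //; rewrite inE -cov -eC covC.
  by rewrite -(card_imset _ S_inj) -eC.
move=> [J]; rewrite inE -cov => /andP[c PJ] ->.
rewrite c card_imset// PJ andbT; split => //.
by apply/fintype.subsetP => _ /imsetP[j _ ->]; rewrite mem_nth.
Qed.

Section ReducedFamily.
Variables (p n m : nat) (inc : nat -> nat -> bool).
Local Notation H := (num_groups p m).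
Local Notation ncol := (num_cols p n m).
Local Notation nrow := (num_rows p m).
Local Notation entry := (entry p n m inc).

Definition reduced_sets : seq {set 'I_ncol} :=
  [seq [set u : 'I_ncol | entry j u] | j <- iota 0 nrow].

Lemma last_row j : j < nrow -> H.-1 <= j %/ 2 ^ p -> j = H.-1 * 2 ^ p.
Proof.
rewrite /num_rows addn1 ltnS leq_divRL ?expn_gt0// => jl lj.
by apply/eqP; rewrite eqn_leq jl lj.
Qed.

Lemma group_part_last : group_part p n m (H.-1 * 2 ^ p) (n + H.-1).
Proof.
rewrite /group_part mulnK ?expn_gt0// eqxx; apply/allP => i.
rewrite mem_iota /= => ip.
by rewrite -[_ * 2 ^ p]addn0 bit_add_mul// /bit div0n.
Qed.

Lemma entry_group_eq j j' : j < nrow ->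
  (forall u : 'I_ncol, entry j u = entry j' u) ->
  group_part p n m j (n + j %/ 2 ^ p) -> j' %/ 2 ^ p = j %/ 2 ^ p.
Proof.
move=> jn ee gp; have gH := row_group_lt jn.
have gc : n + j %/ 2 ^ p < ncol by rewrite /num_cols -addnA ltn_add2l ltn_addr.
have /= := ee (Ordinal gc); rewrite !entry_group// gp => /esym/andP[].
by rewrite eqn_add2l => /eqP.
Qed.

Lemma reduced_sets_uniq : uniq reduced_sets.
Proof.
rewrite map_inj_in_uniq ?iota_uniq// => j j'; rewrite !mem_iota /= !add0n.
move=> jn jn' /setP ee0.
have ee (u : 'I_ncol) : entry j u = entry j' u by have := ee0 u; rewrite !inE.
have lastP a b : a < nrow -> b < nrow ->
    (forall u : 'I_ncol, entry a u = entry b u) -> H.-1 <= a %/ 2 ^ p -> a = b.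
  move=> an bn eab la; have ea := last_row an la.
  have eb : b %/ 2 ^ p = a %/ 2 ^ p.
    by rewrite (entry_group_eq an eab)// ea mulnK ?expn_gt0// group_part_last.
  by rewrite ea (last_row bn)// eb.
have [gl|gl] := leqP H.-1 (j %/ 2 ^ p); first exact: lastP.
have [gl'|gl'] := leqP H.-1 (j' %/ 2 ^ p); first by apply/esym; exact: lastP.
have same_bits i : i < p -> bit i j = bit i j'.
  move=> ip.
  have uc : n + H + i < ncol by rewrite /num_cols ltn_add2l.
  have /= := ee (Ordinal uc); rewrite !entry_label//.
  by move: gl gl'; rewrite /num_groups addn2 /= !ltnS => gl gl';
    rewrite ![_.+1 <= (_ %/ _)]ltnNge gl gl' !orbF.
have same_mod : j %% 2 ^ p = j' %% 2 ^ p.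
  rewrite (@of_bits_ext p (j %% 2 ^ p) (fun i => bit i j')).
  - apply/esym/of_bits_ext => [|i ip]; first by rewrite ltn_pmod ?expn_gt0.
    by rewrite [in RHS](divn_eq j' (2 ^ p)) bit_add_mul.
  - by rewrite ltn_pmod ?expn_gt0.
  - move=> i ip; rewrite -same_bits//.
    by rewrite [in RHS](divn_eq j (2 ^ p)) bit_add_mul.
suff same_div : j %/ 2 ^ p = j' %/ 2 ^ p.
  by rewrite (divn_eq j (2 ^ p)) (divn_eq j' (2 ^ p)) same_mod same_div.
have invalid a : a %/ 2 ^ p < H.-1 ->
    ~~ group_part p n m a (n + a %/ 2 ^ p) -> a %/ 2 ^ p = m %/ p.
  rewrite /num_groups addn2 /= ltnS /group_part eqxx /= => ga.
  move=> /allPn[i]; rewrite mem_iota negb_imply -leqNgt /= => ip /andP[_ mi].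
  apply/eqP; rewrite eqn_leq ga /= -ltnS ltn_divLR ?(leq_ltn_trans _ ip)//.
  by rewrite (leq_ltn_trans mi)// mulSn addnC ltn_add2r.
have [v|v] := boolP (group_part p n m j (n + j %/ 2 ^ p)).
  by rewrite (entry_group_eq jn ee v).
have [v'|v'] := boolP (group_part p n m j' (n + j' %/ 2 ^ p)).
  by rewrite (entry_group_eq jn' _ v').
exact: etrans (invalid _ gl v) (esym (invalid _ gl' v')).
Qed.

Definition reduced_family : set_family := SetFamily reduced_sets_uniq.

Lemma size_reduced : size (sets reduced_family) = nrow.
Proof. by rewrite size_map size_iota. Qed.

Lemma reduced_entry j (u : 'I_ncol) : j < nrow ->
  (u \in nth finset.set0 (sets reduced_family) j) = entry j u.
Proof.
by move=> jn; rewrite /= (nth_map 0) ?size_iota// nth_iota// inE.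
Qed.

Lemma card_ord_count N (f : pred nat) :
  #|[set u : 'I_N | f u]| = count f (iota 0 N).
Proof.
rewrite -sum1_card -sum1_count -[X in iota 0 X]subn0 big_mkord.
by apply: eq_bigl => u; rewrite inE.
Qed.

Lemma count_has (T : Type) (f : nat -> pred T) (s : seq nat) (t : seq T) k :
  (forall i, count (f i) t <= k) ->
  count (fun x => has (fun i => f i x) s) t <= size s * k.
Proof.
move=> fk; elim: s => [|i s IH] /=; first by rewrite count_pred0.
rewrite mulSn (leq_trans _ (leq_add (fk i) IH))//.
by rewrite -count_predUI leq_addr.
Qed.

Lemma reduced_bounded k : (forall i, count (inc i) (iota 0 n) <= k) ->
  sets_bounded (k * p + p + 1) reduced_family.
Proof.
move=> inck X /mapP[j _ ->]; rewrite card_ord_count.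
have count_eq a : count (fun u => u == a) (iota 0 ncol) <= 1.
  by rewrite (count_uniq_mem a (iota_uniq _ _)) leq_b1.
have count_orig : count (orig_part p n inc j) (iota 0 ncol) <= k * p.
  pose f i u := (u < n) && inc (j %/ 2 ^ p * p + i) u.
  rewrite mulnC -[X in X * k](size_iota 0 p).
  apply: leq_trans (sub_count _ _) (@count_has _ f _ _ _ _).
    move=> u /andP[un /hasP[i ip /andP[_ iu]]]; apply/hasP; exists i => //.
    by rewrite /f un.
  move=> i; rewrite /num_cols -addnA iotaD count_cat.
  rewrite [X in _ + X](_ : _ = 0) ?addn0.
    apply: leq_trans (sub_count _ _) (inck (j %/ 2 ^ p * p + i)).
    by move=> u /andP[].
  apply/eqP; rewrite eqn0Ngt -has_count; apply/hasPn => u.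
  by rewrite mem_iota add0n => /andP[nu _]; rewrite /f ltnNge nu.
have count_label : count (label_part p n m j) (iota 0 ncol) <= p.
  pose f i u := u == n + H + i.
  rewrite -[leqRHS]muln1 -[X in X * 1](size_iota 0 p).
  apply: leq_trans (sub_count _ _) (@count_has _ f _ _ _ _).
    by move=> u /hasP[i ip /andP[e _]]; apply/hasP; exists i.
  by move=> i; exact: count_eq.
have count_group : count (group_part p n m j) (iota 0 ncol) <= 1.
  apply: leq_trans (sub_count _ _) (count_eq (n + j %/ 2 ^ p)).
  by move=> u /andP[].
rewrite addnAC -addnA.
apply: leq_trans (leq_add count_orig (leq_add count_group count_label)).
have U (a b : pred nat) s :
    count (fun x => a x || b x) s <= count a s + count b s.
  by rewrite -count_predUI leq_addr.
by apply: leq_trans (U _ _ _) _; rewrite leq_add2l U.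
Qed.

End ReducedFamily.

Definition incident (F : set_family) (i u : nat) : bool :=
  [exists x : 'I_(univ_size F),
    (val x == u) && (x \in nth finset.set0 (sets F) i)].

Lemma incidentE (F : set_family) i (u : 'I_(univ_size F)) :
  incident F i u = (u \in nth finset.set0 (sets F) i).
Proof.
apply/existsP/idP => [[x /andP[/eqP/val_inj -> //]]|ui].
by exists u; rewrite eqxx.
Qed.

Lemma count_incident F k i : sets_bounded k F ->
  count (incident F i) (iota 0 (univ_size F)) <= k.
Proof.
move=> Fk; rewrite -card_ord_count.
have -> : [set u : 'I_(univ_size F) | incident F i u] =
          nth finset.set0 (sets F) i.
  by apply/setP => u; rewrite inE incidentE.
have [im|mi] := ltnP i (size (sets F)); first exact/Fk/mem_nth.
by rewrite nth_default// finset.cards0.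
Qed.

Definition reduce (p : nat) (F : set_family) : set_family :=
  reduced_family p (univ_size F) (size (sets F)) (incident F).

Lemma card_covers_reduce p F : 0 < p ->
  #|[set C in covers (reduce p F) | #|C| == num_groups p (size (sets F))]| =
  #|covers F|.
Proof.
move=> p0; set m := size (sets F); set n := univ_size F.
rewrite (@card_covers _ (pred1 (num_groups p m)) (entry p n m (incident F))).
  rewrite size_reduced (@card_index_covers p n m (incident F))//.
  have := @card_covers F predT (incident F) (fun j => incidentE j).
  rewrite (_ : [set C in covers F | predT #|C| ] = covers F).
    by move->; apply: eq_card => I; rewrite !inE andbT.
  by apply/setP => C; rewrite inE andbT.
move=> j u; rewrite reduced_entry//.
by rewrite -[X in _ < X](size_reduced p n m (incident F)).
Qed.

Lemma size_incidence F : size (incidence F) = size (sets F) * univ_size F.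
Proof.
rewrite /incidence; elim: (sets F) => //= X s IH.
by rewrite size_cat IH size_map size_enum_ord mulSn.
Qed.

Lemma nth_incidence F i (u : 'I_(univ_size F)) :
  nth 0 (incidence F) (i * univ_size F + u) =
  (u \in nth finset.set0 (sets F) i) :> nat.
Proof.
rewrite /incidence; elim: (sets F) i => [|X s IH] [|i] /=.
- by rewrite nth_nil finset.in_set0.
- by rewrite nth_nil finset.in_set0.
- rewrite mul0n add0n nth_cat size_map size_enum_ord ltn_ord.
  by rewrite (nth_map u) ?size_enum_ord// nth_ord_enum.
- rewrite nth_cat size_map size_enum_ord mulSn -addnA ltnNge leq_addr /=.
  by rewrite addKn IH.
Qed.

(** * The program *)

Lemma ltn_bitlen a : a < 2 ^ bitlen a.
Proof. exact: trunc_log_ltn. Qed.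

Lemma bitlen_le_exp a k : 0 < k -> a < 2 ^ k -> bitlen a <= k.
Proof.
move=> k0; case: a => [|a] ak; first by rewrite /bitlen trunc_log0.
rewrite /bitlen -(ltn_exp2l _ _ (ltnSn 1)) (leq_ltn_trans _ ak)//.
exact: trunc_logP.
Qed.

Lemma bitlen_leS a : bitlen a <= a.+1.
Proof. by apply: bitlen_le_exp => //; rewrite (ltn_trans _ (ltn_expl _ _)). Qed.

Lemma bitlen_bool (b : bool) : bitlen b = 1.
Proof. by case: b; rewrite /bitlen ?trunc_log1 ?trunc_log0. Qed.

Lemma leq_bitlen a b : a <= b -> bitlen a <= bitlen b.
Proof.
move=> ab; apply: bitlen_le_exp => //.
exact: leq_ltn_trans ab (ltn_bitlen b).
Qed.

Lemma bitlen_binop o a b : bitlen (binop_sem o a b) <= bitlen a + bitlen b.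
Proof.
have la := ltn_bitlen a; have lb := ltn_bitlen b.
case: o => /=.
- apply: bitlen_le_exp; rewrite ?addn_gt0// expnD.
  have : 1 <= bitlen a by []. have : 1 <= bitlen b by [].
  move=> /(leq_pexp2l (isT : 0 < 2)); rewrite expn1 => h1.
  move=> /(leq_pexp2l (isT : 0 < 2)); rewrite expn1 => h2.
  by move: (2 ^ bitlen a) (2 ^ bitlen b) la lb h1 h2 => x y; nia.
- by rewrite (leq_trans (leq_bitlen (leq_subr _ _)))// leq_addr.
- apply: bitlen_le_exp; rewrite ?addn_gt0// expnD.
  by rewrite (leq_ltn_trans (leq_mul (leqnn a) (ltnW lb)))// ltn_mul2r expn_gt0.
- by rewrite (leq_trans (leq_bitlen (leq_div _ _)))// leq_addr.
Qed.

Definition bounded (s : state) (B : nat) : Prop :=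
  (forall i, bitlen (reg s i) <= B) /\ (forall a, bitlen (cell s a) <= B).

Fixpoint value_weight (e : expr) : nat :=
  match e with
  | Const a => bitlen a
  | Reg _ | Fetch _ => 1
  | Bin _ e1 e2 => value_weight e1 + value_weight e2
  end.

Fixpoint cost_weight (e : expr) : nat :=
  value_weight e +
  match e with
  | Const _ | Reg _ => 0
  | Fetch e1 => cost_weight e1
  | Bin _ e1 e2 => cost_weight e1 + cost_weight e2
  end.

Lemma bounded_gt0 s B : bounded s B -> 0 < B.
Proof. by move=> [+ _] => /(_ 0); apply: leq_trans. Qed.

Lemma bitlen_eval s B e : bounded s B ->
  bitlen (eval_expr s e) <= value_weight e * B.
Proof.
move=> sB; have B0 := bounded_gt0 sB; case: sB => rB cB.
elim: e => [a|i|e _|o e1 IH1 e2 IH2] /=; rewrite ?mul1n//.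
  by rewrite leq_pmulr.
by rewrite (leq_trans (bitlen_binop _ _ _))// mulnDl leq_add.
Qed.

Lemma expr_cost_le s B e : bounded s B -> expr_cost s e <= cost_weight e * B.
Proof.
move=> sB; elim: e => [a|i|e IH|o e1 IH1 e2 IH2];
  rewrite [cost_weight _]/= mulnDl; apply: leq_add;
  rewrite ?(bitlen_eval _ sB)//.
by rewrite mulnDl leq_add.
Qed.

Fixpoint cmd_weight (c : cmd) : nat :=
  match c with
  | Skip | Toss _ => 1
  | Assign _ e => (cost_weight e).+1
  | Store e1 e2 => (cost_weight e1 + cost_weight e2).+1
  | Seq c1 c2 => cmd_weight c1 + cmd_weight c2
  | If e c1 c2 => (cost_weight e + cmd_weight c1 + cmd_weight c2).+1
  | While e c => (cost_weight e + cmd_weight c).+1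
  end.

Definition runs (c : cmd) (s s' : state) (D : nat) : Prop :=
  forall r, exists2 t, exec c s r t s' r & t <= cmd_weight c * D.

Lemma runs_leq c s s' D D' : D <= D' -> runs c s s' D -> runs c s s' D'.
Proof.
move=> DD h r; have [t e l] := h r; exists t => //.
by rewrite (leq_trans l)// leq_mul2l DD orbT.
Qed.

Lemma runs_assign s B i e s' : bounded s B ->
  set_reg s i (eval_expr s e) = s' -> runs (Assign i e) s s' B.
Proof.
move=> sB <- r; exists (expr_cost s e).+1; first exact: ExecAssign.
by rewrite mulSn -add1n leq_add ?(bounded_gt0 sB)// expr_cost_le.
Qed.

Lemma runs_store s B e1 e2 s' : bounded s B ->
  set_cell s (eval_expr s e1) (eval_expr s e2) = s' ->
  runs (Store e1 e2) s s' B.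
Proof.
move=> sB <- r; exists (expr_cost s e1 + expr_cost s e2).+1.
  exact: ExecStore.
rewrite mulSn -add1n leq_add ?(bounded_gt0 sB)//.
by rewrite mulnDl leq_add// expr_cost_le.
Qed.

Lemma runs_seq s s1 s2 c1 c2 D :
  runs c1 s s1 D -> runs c2 s1 s2 D -> runs (Seq c1 c2) s s2 D.
Proof.
move=> h1 h2 r; have [t1 e1 l1] := h1 r; have [t2 e2 l2] := h2 r.
by exists (t1 + t2); [exact: ExecSeq e1 e2|rewrite mulnDl leq_add].
Qed.

Lemma runs_countdown (sigma : nat -> state) e c B x :
  (forall y, y <= x -> bounded (sigma y) B) ->
  (forall y, y <= x -> eval_expr (sigma y) e = y) ->
  (forall y, y < x -> runs c (sigma y.+1) (sigma y) B) ->
  runs (While e c) (sigma x) (sigma 0) (x.+1 * B).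
Proof.
move=> sB se sc r; have B0 := bounded_gt0 (sB 0 isT).
suff [t et lt] : exists2 t, exec (While e c) (sigma x) r t (sigma 0) r &
    t <= x.+1 * (cmd_weight (While e c) * B).
  by exists t => //; rewrite mulnCA.
elim: x sB se sc => [|x IH] sB se sc.
  exists (expr_cost (sigma 0) e).+1; first by apply: ExecWhileDone; exact: se.
  rewrite mul1n mulSn -add1n leq_add// mulnDl.
  by rewrite (leq_trans (expr_cost_le _ (sB _ _)))// leq_addr.
have [||| t2 e2 l2] := IH.
- by move=> y yx; apply: sB; rewrite leqW.
- by move=> y yx; apply: se; rewrite leqW.
- by move=> y yx; apply: sc; rewrite leqW.
have [t1 e1 l1] := sc x (ltnSn x) r.
exists (expr_cost (sigma x.+1) e + t1 + t2).+1.
  by apply: ExecWhileLoop e1 e2; rewrite se.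
rewrite mulSn -addSn leq_add// [leqRHS]mulSn -add1n leq_add//.
by rewrite mulnDl leq_add//; exact/expr_cost_le/sB.
Qed.

Lemma bit_exp_le i s : bit i s -> 2 ^ i <= s.
Proof. by apply: contraTT; rewrite -ltnNge => si; rewrite /bit divn_small. Qed.

Lemma bit_set_index_le p i j : i < p -> bit i j -> j %/ 2 ^ p * p + i <= j.
Proof.
move=> ip; rewrite {1 3}(divn_eq j (2 ^ p)) bit_add_mul// => /bit_exp_le b.
rewrite leq_add//; first by rewrite leq_mul2l ltnW ?orbT// ltn_expl.
by rewrite (leq_trans _ b)// ltnW// ltn_expl.
Qed.

Lemma sum_gt0_has (s : seq nat) (f : nat -> nat) :
  (0 < \sum_(i <- s) f i) = has (fun i => 0 < f i) s.
Proof.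
by elim: s => [|i s IH]; rewrite ?big_nil// big_cons addn_gt0 IH.
Qed.

Definition addE := Bin OpAdd.
Definition subE := Bin OpSub.
Definition mulE := Bin OpMul.
Definition divE := Bin OpDiv.
Definition modE a b := subE a (mulE (divE a b) b).
(* Truncated subtraction turns [1 - (a - b)] into the test [a <= b]. *)
Definition posE a := subE (Const 1) (subE (Const 1) a).
Definition leE a b := subE (Const 1) (subE a b).
Definition eqE a b := subE (Const 1) (addE (subE a b) (subE b a)).
Definition bitE i a := modE (divE a (Const (2 ^ i))) (Const 2).
Fixpoint sumE (q : nat) (f : nat -> expr) : expr :=
  if q is q'.+1 then addE (sumE q' f) (f q') else Const 0.

Section EvalBool.
Variable s : state.
Local Notation ev := (eval_expr s).

Lemma eval_mod a b : ev (modE a b) = ev a %% ev b.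
Proof. by rewrite /= {1}(divn_eq (ev a) (ev b)) addKn. Qed.

Lemma eval_pos a : ev (posE a) = (0 < ev a).
Proof. by rewrite /=; case: (ev a) => [|k] //=; lia. Qed.

Lemma eval_le a b : ev (leE a b) = (ev a <= ev b).
Proof. by rewrite /=; case: leqP; lia. Qed.

Lemma eval_eq a b : ev (eqE a b) = (ev a == ev b).
Proof. by rewrite /=; case: eqP; lia. Qed.

Lemma eval_bit i a : ev (bitE i a) = bit i (ev a).
Proof. by rewrite eval_mod modn2. Qed.

Lemma eval_sum q f : ev (sumE q f) = \sum_(i <- iota 0 q) ev (f i).
Proof.
elim: q => [|q IH]; first by rewrite big_nil.
by rewrite -[q.+1]addn1 iotaD big_cat big_seq1 addn1 /= IH.
Qed.

Lemma eval_sum_gt0 q f :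
  (0 < ev (sumE q f)) = has (fun i => 0 < ev (f i)) (iota 0 q).
Proof. by rewrite eval_sum sum_gt0_has. Qed.

End EvalBool.

(* Registers 1, 2 and 3 hold [n], [m] and the position of the entry in the
   row-major incidence matrix. *)
Section EntryProgram.
Variable p : nat.

Definition groupsE := addE (divE (Reg 2) (Const p)) (Const 2).
Definition colsE := addE (addE (Reg 1) groupsE) (Const p).
Definition rowsE :=
  addE (mulE (subE groupsE (Const 1)) (Const (2 ^ p))) (Const 1).
Definition rowE := divE (Reg 3) colsE.
Definition colE := modE (Reg 3) colsE.
Definition groupE := divE rowE (Const (2 ^ p)).
Definition setE i := addE (mulE groupE (Const p)) (Const i).
Definition fetchE i :=
  Fetch (addE (Const 2) (addE (mulE (setE i) (Reg 1)) colE)).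
Definition origE :=
  mulE (leE (addE colE (Const 1)) (Reg 1))
       (sumE p (fun i => mulE (bitE i rowE) (fetchE i))).
Definition validE :=
  leE (sumE p (fun i => mulE (bitE i rowE)
                             (subE (addE (setE i) (Const 1)) (Reg 2))))
      (Const 0).
Definition labelE :=
  sumE p (fun i => mulE (eqE colE (addE (addE (Reg 1) groupsE) (Const i)))
    (addE (bitE i rowE) (leE groupsE (addE groupE (Const 1))))).
Definition entryE :=
  posE (addE origE
    (addE (mulE (eqE colE (addE (Reg 1) groupE)) validE) labelE)).

Variables (s : state) (n m x : nat) (inc : nat -> nat -> bool).
Hypotheses (s1 : reg s 1 = n) (s2 : reg s 2 = m) (s3 : reg s 3 = x).
Local Notation ev := (eval_expr s).
Local Notation j := (x %/ num_cols p n m).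
Local Notation u := (x %% num_cols p n m).

Lemma eval_groups : ev groupsE = num_groups p m.
Proof. by rewrite /= s2. Qed.

Lemma eval_cols : ev colsE = num_cols p n m.
Proof. by rewrite /= s1 s2. Qed.

Lemma eval_rows : ev rowsE = num_rows p m.
Proof. by rewrite /= s2 /num_rows subn1. Qed.

Lemma eval_row : ev rowE = j.
Proof. by rewrite -eval_cols /= s3. Qed.

Lemma eval_col : ev colE = u.
Proof. by rewrite eval_mod eval_cols /= s3. Qed.

Lemma eval_group : ev groupE = j %/ 2 ^ p.
Proof. by rewrite -eval_row. Qed.

Lemma eval_set i : ev (setE i) = j %/ 2 ^ p * p + i.
Proof. by rewrite -eval_group. Qed.

Hypothesis mem_s : forall i v, v < n -> 2 + (i * n + v) < 3 + x ->
  cell s (2 + (i * n + v)) = inc i v.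

Lemma num_cols_gt0 : 0 < num_cols p n m.
Proof. by rewrite /num_cols addn_gt0 (addn_gt0 n) num_groups_gt0 orbT. Qed.

(* A selected set precedes the row being written, so that its incidence bits
   have not been overwritten yet. *)
Lemma cell_set i : u < n -> i < p -> bit i j ->
  ev (fetchE i) = inc (j %/ 2 ^ p * p + i) u.
Proof.
move=> un ip b; rewrite -mem_s//.
  rewrite -[LHS]/(cell s (2 + (ev (setE i) * reg s 1 + ev colE))).
  by rewrite eval_set s1 eval_col.
rewrite !addSn !ltnS add0n {3}(divn_eq x (num_cols p n m)) leq_add2r.
rewrite leq_mul ?bit_set_index_le//.
by rewrite /num_cols -addnA leq_addr.
Qed.

Lemma ev_mul_gt0 a b : (0 < ev (mulE a b)) = (0 < ev a) && (0 < ev b).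
Proof. by rewrite /= muln_gt0. Qed.

Lemma ev_add_gt0 a b : (0 < ev (addE a b)) = (0 < ev a) || (0 < ev b).
Proof. by rewrite /= addn_gt0. Qed.

Lemma eval_orig : (0 < ev origE) = orig_part p n inc j u.
Proof.
rewrite ev_mul_gt0 eval_le eval_sum_gt0 lt0b /orig_part.
rewrite -[ev (addE _ _)]/(ev colE + 1) eval_col addn1 [ev (Reg 1)]s1.
have [un|//] := ltnP u n; apply: eq_in_has => i.
rewrite mem_iota add0n => /andP[_ ip]; cbv beta.
rewrite ev_mul_gt0 eval_bit eval_row lt0b; have [b|//] := boolP (bit i j).
by rewrite cell_set// lt0b.
Qed.

Lemma eval_group_part :
  (0 < ev (mulE (eqE colE (addE (Reg 1) groupE)) validE)) =
  group_part p n m j u.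
Proof.
rewrite ev_mul_gt0 eval_eq eval_le !lt0b leqNgt -[ev (Const 0)]/0 eval_sum_gt0.
rewrite eval_col.
rewrite -[ev (addE _ _)]/(ev (Reg 1) + ev groupE) [ev (Reg 1)]s1 eval_group.
congr (_ && _); rewrite -all_predC; apply: eq_in_all => i _.
rewrite -[LHS]/(~~ (0 < _)) ev_mul_gt0 eval_bit eval_row lt0b negb_and implybE.
congr (_ || _); rewrite -leqNgt.
rewrite -[ev (subE _ _)]/(ev (setE i) + 1 - reg s 2) s2 eval_set addn1.
by rewrite leqn0 subn_eq0.
Qed.

Lemma eval_label : (0 < ev labelE) = label_part p n m j u.
Proof.
rewrite eval_sum_gt0; apply: eq_in_has => i _; cbv beta.
rewrite ev_mul_gt0 ev_add_gt0 eval_eq eval_bit eval_le !lt0b eval_col eval_row.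
rewrite -[ev (addE (addE _ _) _)]/(reg s 1 + ev groupsE + i) s1 eval_groups.
by rewrite -[ev (addE groupE _)]/(ev groupE + 1) eval_group addn1.
Qed.

Lemma eval_entry : ev entryE = entry p n m inc j u.
Proof.
by rewrite eval_pos 2!ev_add_gt0 eval_orig eval_group_part eval_label.
Qed.

End EntryProgram.

Lemma upd_leq f i v V : (forall k, f k <= V) -> v <= V ->
  forall k, upd f i v k <= V.
Proof. by move=> fV vV k; rewrite /upd; case: eqP. Qed.

Lemma bounded_leq f g V : (forall i, f i <= V) -> (forall a, g a <= V) ->
  bounded (State f g) V.+1.
Proof.
by move=> fV gV; split => i /=; rewrite (leq_trans (bitlen_leS _))// ltnS.
Qed.

Lemma incidence_leq1 F a : nth 0 (incidence F) a <= 1.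
Proof.
have /all_nthP h : all (leq^~ 1) (incidence F).
  by apply/allP => _ /flattenP[_ /mapP[X _ ->] /mapP[u _ ->]]; exact: leq_b1.
have [am|ma] := ltnP a (size (incidence F)); first exact: h.
by rewrite nth_default.
Qed.

Definition fill (p : nat) : cmd :=
  While (Reg 3)
    (Seq (Assign 3 (subE (Reg 3) (Const 1)))
         (Store (addE (Const 3) (Reg 3)) (entryE p))).

Definition reduce_cmd (p : nat) : cmd :=
  Seq (Assign 1 (Fetch (Const 0)))
 (Seq (Assign 2 (Fetch (Const 1)))
 (Seq (Assign 3 (mulE (rowsE p) (colsE p)))
 (Seq (fill p)
 (Seq (Store (Const 0) (colsE p))
 (Seq (Store (Const 1) (groupsE p))
 (Seq (Store (Const 2) (rowsE p))
 (Seq (Assign 1 (Const 0)) (Assign 2 (Const 0))))))))).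

Section ReduceProgram.
Variables (p : nat) (F : set_family).
Hypothesis p_gt0 : 0 < p.
Local Notation n := (univ_size F).
Local Notation m := (size (sets F)).
Local Notation H := (num_groups p m).
Local Notation ncol := (num_cols p n m).
Local Notation nrow := (num_rows p m).
Local Notation tot := (nrow * ncol).
Local Notation ent x := (entry p n m (incident F) (x %/ ncol) (x %% ncol)).

Definition sparse_word : seq nat := [:: n, m & incidence F].
Definition parity_word : seq nat :=
  [:: ncol, H, nrow & incidence (reduce p F)].

Definition reduce_value_bound : nat := n + m + tot + 1.
Local Notation V := reduce_value_bound.

Definition loop_reg (x : nat) : nat -> nat :=
  upd (upd (upd (fun=> 0) 1 n) 2 m) 3 x.

Definition loop_cell (x a : nat) : nat :=
  if 3 + x <= a < 3 + tot then ent (a - 3) : nat else nth 0 sparse_word a.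

Definition loop_state (x : nat) : state := State (loop_reg x) (loop_cell x).

Lemma sparse_word_leq a : nth 0 sparse_word a <= V.
Proof.
rewrite /V; case: a => [|[|a]] /=; [lia|lia|].
by rewrite (leq_trans (incidence_leq1 _ _))// leq_addl.
Qed.

Lemma loop_cell_leq x a : loop_cell x a <= V.
Proof.
rewrite /loop_cell; case: ifP => _; last exact: sparse_word_leq.
by rewrite (leq_trans (leq_b1 _))// leq_addl.
Qed.

Lemma nrow_gt0 : 0 < nrow. Proof. by rewrite /num_rows addn1. Qed.

Lemma ncol_leq : ncol <= V.
Proof. by rewrite /V; have := leq_pmull ncol nrow_gt0; lia. Qed.

Lemma nrow_leq : nrow <= V.
Proof. by rewrite /V; have := leq_pmulr nrow (num_cols_gt0 p n m); lia. Qed.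

Lemma groups_leq : H <= V.
Proof. by apply: leq_trans ncol_leq; rewrite /num_cols addnAC leq_addl. Qed.

Lemma size_sparse_word : size sparse_word <= 3 + tot.
Proof.
rewrite /= size_incidence !addSn !ltnS add0n leqW// leq_mul//.
  rewrite /num_rows addn1 leqW// (leq_trans (last_group_ge _ p_gt0 0))//.
  by rewrite addn0 leq_mul2l ltnW ?orbT// ltn_expl.
by rewrite /num_cols -addnA leq_addr.
Qed.

Lemma nth_sparse_word i v : v < n ->
  nth 0 sparse_word (2 + (i * n + v)) = incident F i v.
Proof.
by move=> vn; rewrite /= -[v]/(val (Ordinal vn)) nth_incidence incidentE.
Qed.

Lemma loop_step_runs x : x < tot ->
  runs (Seq (Assign 3 (subE (Reg 3) (Const 1)))
         (Store (addE (Const 3) (Reg 3)) (entryE p)))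
    (loop_state x.+1) (loop_state x) V.+1.
Proof.
move=> xt.
have regV y : y <= tot -> forall i, loop_reg y i <= V.
  by move=> yt; rewrite /loop_reg /V; do 3!(apply: upd_leq; last lia).
apply: (@runs_seq _ (State (loop_reg x) (loop_cell x.+1))).
  apply: runs_assign; first exact: (bounded_leq (regV _ _) (loop_cell_leq _)).
  rewrite /set_reg /= subn1 /=; congr State; apply/funext => i.
  by rewrite /loop_reg /upd; case: (i == 3).
apply: runs_store; first exact/(bounded_leq (regV _ (ltnW xt)))/loop_cell_leq.
rewrite (@eval_entry p _ n m x (incident F))//; last first.
  move=> i v vn lx; rewrite /= /loop_cell ifN ?nth_sparse_word//.
  by rewrite negb_and -ltnNge (leq_trans lx)// orTb.
congr State; apply/funext => a; rewrite /= /upd /loop_cell.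
rewrite [loop_reg _ _]/=.
have [->|ax] := eqVneq a (3 + x).
  by rewrite leqnn ltn_add2l xt addKn.
by rewrite addnS [3 + x <= a]leq_eqVlt eq_sym (negbTE ax).
Qed.

Lemma fill_runs : runs (fill p) (loop_state tot) (loop_state 0) (tot.+1 * V.+1).
Proof.
apply: runs_countdown => // y yt; last exact: loop_step_runs.
apply: bounded_leq; last exact: loop_cell_leq.
by rewrite /loop_reg /V; do 3!(apply: upd_leq; last lia).
Qed.

Lemma nth_parity_word x : nth 0 (incidence (reduce p F)) x =
  if x < tot then ent x : nat else 0.
Proof.
have [xt|tx] := ltnP x tot; last first.
  by rewrite nth_default// size_incidence size_reduced.
have c0 := num_cols_gt0 p n m.
have xn : x %% ncol < ncol by rewrite ltn_pmod.
rewrite {1}(divn_eq x ncol).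
have := @nth_incidence (reduce p F) (x %/ ncol) (Ordinal xn).
rewrite [univ_size _]/= [val _]/= => ->.
by rewrite reduced_entry// ltn_divLR.
Qed.

Lemma reduce_runs :
  runs (reduce_cmd p) (init sparse_word) (init parity_word) (tot.+1 * V.+1).
Proof.
have D : V.+1 <= tot.+1 * V.+1 by rewrite leq_pmull.
have zV : forall i, (fun=> 0) i <= V by [].
have nV : n <= V by rewrite /V; lia.
have mV : m <= V by rewrite /V; lia.
have tV : tot <= V by rewrite /V; lia.
have wV := sparse_word_leq.
apply: (@runs_seq _ (State (upd (fun=> 0) 1 n) (nth 0 sparse_word))).
  by apply: runs_leq D (runs_assign (bounded_leq _ _) _).
apply: (@runs_seq _ (State (upd (upd (fun=> 0) 1 n) 2 m) (nth 0 sparse_word))).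
  by apply: runs_leq D (runs_assign (bounded_leq (upd_leq _ _ _) _) _).
apply: (@runs_seq _ (loop_state tot)).
  apply: runs_leq D (runs_assign _ _).
    by apply: bounded_leq => //; do 2!apply: upd_leq => //.
  rewrite /set_reg (_ : eval_expr _ _ = tot); last first.
    rewrite -[LHS]/(eval_expr _ (rowsE p) * eval_expr _ (colsE p)).
    by rewrite (@eval_rows p _ m)// (@eval_cols p _ n m).
  congr State; apply/funext => a; rewrite /= /loop_cell ifN//.
  by apply/negP => /andP[h1 h2]; have := leq_trans h2 h1; rewrite ltnn.
apply: (runs_seq fill_runs).
have rV : forall i, loop_reg 0 i <= V.
  by rewrite /loop_reg; do 3!apply: upd_leq => //.
pose g0 := upd (loop_cell 0) 0 ncol.
pose g1 := upd g0 1 H; pose g2 := upd g1 2 nrow.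
have g0V a : g0 a <= V := upd_leq 0 (loop_cell_leq 0) ncol_leq a.
have g1V a : g1 a <= V := upd_leq 1 g0V groups_leq a.
have g2V a : g2 a <= V := upd_leq 2 g1V nrow_leq a.
apply: (@runs_seq _ (State (loop_reg 0) g0)).
  apply: runs_leq D (runs_store (bounded_leq rV (loop_cell_leq 0)) _).
  by rewrite (@eval_cols p _ n m).
apply: (@runs_seq _ (State (loop_reg 0) g1)).
  apply: runs_leq D (runs_store (bounded_leq rV g0V) _).
  by rewrite (@eval_groups p _ m).
apply: (@runs_seq _ (State (loop_reg 0) g2)).
  apply: runs_leq D (runs_store (bounded_leq rV g1V) _).
  by rewrite (@eval_rows p _ m).
apply: (@runs_seq _ (State (upd (loop_reg 0) 1 0) g2)).
  exact: runs_leq D (runs_assign (bounded_leq rV g2V) _).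
apply: runs_leq D (runs_assign (bounded_leq _ g2V) _); first exact: upd_leq.
congr State; apply/funext => i.
  by rewrite /loop_reg /upd; case: i => [|[|[|[|i]]]].
case: i => [|[|[|a]]] //=.
rewrite nth_parity_word /g2 /g1 /g0 /upd /= /loop_cell.
rewrite -[a.+3]/(3 + a) leq_addr ltn_add2l addKn /=.
case: ltnP => // ta; rewrite nth_default//.
by rewrite -2!ltnS (leq_trans size_sparse_word)// leq_add2l.
Qed.

End ReduceProgram.

(** * Running time *)

Lemma leq_horner (q : {poly nat}) x y : x <= y -> q.[x]%R <= q.[y]%R.
Proof.
move=> xy; rewrite !horner_coef; apply: leq_sum => i _.
by rewrite leq_mul//; have [->//|i0] := posnP i; rewrite !natrXE leq_exp2r.
Qed.

Definition poly_bounded (f : nat -> nat) : Prop :=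
  exists q : {poly nat}, forall x, f x <= q.[x]%R.

Lemma poly_bounded_const a : poly_bounded (fun=> a).
Proof. by exists a%:P%R => x; rewrite hornerC. Qed.

Lemma poly_bounded_id : poly_bounded id.
Proof. by exists 'X%R => x; rewrite hornerX. Qed.

Lemma poly_bounded_add f g : poly_bounded f -> poly_bounded g ->
  poly_bounded (fun x => f x + g x).
Proof.
by move=> [q hq] [q' hq']; exists (q + q')%R => x; rewrite hornerD leq_add.
Qed.

Lemma poly_bounded_mul f g : poly_bounded f -> poly_bounded g ->
  poly_bounded (fun x => f x * g x).
Proof.
by move=> [q hq] [q' hq']; exists (q * q')%R => x; rewrite hornerM leq_mul.
Qed.

Lemma poly_bounded_horner (q : {poly nat}) f : poly_bounded f ->
  poly_bounded (fun x => q.[f x]%R).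
Proof.
by move=> [q' hq']; exists (q \Po q')%R => x; rewrite horner_comp leq_horner.
Qed.

Lemma covers_nil F : sets F = [::] -> odd #|covers F| = (univ_size F == 0).
Proof.
move=> F0.
have coversE C : (C \in covers F) = (C == finset.set0) && (univ_size F == 0).
  rewrite inE; have -> : (C \subset sets F) = (C == finset.set0).
    rewrite -finset.subset0; apply: eq_subset_r => X.
    by rewrite F0 in_nil finset.in_set0.
  have [->|//] := eqVneq C finset.set0; rewrite finset.big_set0 /=.
  rewrite finset.eqEcard finset.sub0set finset.cards0 finset.cardsT card_ord.
  by rewrite leqn0.
have [n0|n0] := eqVneq (univ_size F) 0.
  have -> : covers F = [set finset.set0].
    by apply/setP => C; rewrite coversE (introT eqP n0) andbT finset.in_set1.
  by rewrite cards1.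
rewrite (_ : covers F = finset.set0) ?finset.cards0//.
by apply/setP => C; rewrite coversE (negbTE n0) andbF finset.in_set0.
Qed.

Lemma bounded_init (w : seq nat) : 0 < size w ->
  bounded (init w) (\sum_(a <- w) bitlen a).
Proof.
move=> w0; have le a : bitlen (nth 0 w a) <= \sum_(a <- w) bitlen a.
  have [aw|wa] := ltnP a (size w).
    by rewrite (big_nth 0) big_mkord (bigD1 (Ordinal aw)) //= leq_addr.
  rewrite nth_default// (@leq_trans (bitlen (nth 0 w 0)))//.
  by rewrite (big_nth 0) big_mkord (bigD1 (Ordinal w0)) //= leq_addr.
by split => [i|a] /=; rewrite ?le// (leq_trans _ (le 0)).
Qed.

Lemma size_leq_bitlen (w : seq nat) : size w <= \sum_(a <- w) bitlen a.
Proof. by rewrite -sum1_size; apply: leq_sum. Qed.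

Lemma sum_bitlen_incidence F :
  \sum_(a <- incidence F) bitlen a = size (sets F) * univ_size F.
Proof.
rewrite -size_incidence -sum1_size; apply: eq_big_seq => a.
by move=> /flattenP[_ /mapP[X _ ->] /mapP[u _ ->]]; rewrite bitlen_bool.
Qed.

Section Bounds.
Variables (p n m N : nat).
Hypotheses (nN : n <= N) (mN : m <= N).

Definition groups_bound x := x + 2.
Definition cols_bound x := x + groups_bound x + p.
Definition rows_bound x := (x + 1) * 2 ^ p + 1.
Definition value_bound x := x + x + rows_bound x * cols_bound x + 1.
Definition time_bound x :=
  (rows_bound x * cols_bound x + 1) * (value_bound x + 1).
Definition size_bound x :=
  cols_bound x + 1 + (groups_bound x + 1) + (rows_bound x + 1) +
  rows_bound x * cols_bound x.

Lemma num_groups_leq : num_groups p m <= groups_bound N.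
Proof. by rewrite leq_add2r (leq_trans (leq_div _ _)). Qed.

Lemma num_cols_leq : num_cols p n m <= cols_bound N.
Proof. by rewrite leq_add2r leq_add// num_groups_leq. Qed.

Lemma num_rows_leq : num_rows p m <= rows_bound N.
Proof.
rewrite leq_add2r leq_mul2r /num_groups addn2 /= addn1 ltnS.
by rewrite (leq_trans (leq_div _ _))// orbT.
Qed.

End Bounds.

Ltac poly_bounded_tac :=
  repeat first [apply: poly_bounded_add | apply: poly_bounded_mul |
    exact: poly_bounded_id | exact: poly_bounded_const].

Lemma poly_bounded_time p : poly_bounded (time_bound p).
Proof.
rewrite /time_bound /value_bound /rows_bound /cols_bound /groups_bound.
by poly_bounded_tac.
Qed.

Lemma poly_bounded_size p : poly_bounded (size_bound p).
Proof.
rewrite /size_bound /rows_bound /cols_bound /groups_bound.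
by poly_bounded_tac.
Qed.

Lemma reduce_time_leq p F N : univ_size F <= N -> size (sets F) <= N ->
  (num_rows p (size (sets F)) *
    num_cols p (univ_size F) (size (sets F))).+1 *
  (reduce_value_bound p F).+1 <= time_bound p N.
Proof.
move=> nN mN; have rc := leq_mul (num_rows_leq p mN) (num_cols_leq p nN mN).
rewrite /time_bound; apply: leq_mul; rewrite addn1 ltnS; first exact: rc.
exact: leq_add (leq_add (leq_add nN mN) rc) (leqnn 1).
Qed.

Lemma parity_size_leq p F N : univ_size F <= N -> size (sets F) <= N ->
  \sum_(a <- parity_word p F) bitlen a <= size_bound p N.
Proof.
move=> nN mN; rewrite /parity_word !big_cons sum_bitlen_incidence size_reduced.
rewrite /size_bound -!addnA.
have b a c : a <= c -> bitlen a <= c + 1.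
  by move=> ac; rewrite (leq_trans (bitlen_leS a))// addn1.
have h1 := b _ _ (num_cols_leq p nN mN).
have h2 := b _ _ (num_groups_leq p mN).
have h3 := b _ _ (num_rows_leq p mN).
have rc := leq_mul (num_rows_leq p mN) (num_cols_leq p nN mN).
by move: (leq_add h1 (leq_add h2 (leq_add h3 rc))); rewrite -!addnA.
Qed.

(* Without sets the input does not contain [n] in unary, so that even writing
   the reduced instance would not be polynomial; answer directly. *)
Definition sparse_cmd (p : nat) (A : cmd) : cmd :=
  If (Fetch (Const 1)) (Seq (reduce_cmd p) A)
     (Assign 0 (subE (Const 1) (Fetch (Const 0)))).

Local Open Scope ring_scope.

Section Reduction.
Variables (R : realType) (k p : nat) (ck e e' : R).
Hypotheses (p_gt0 : (0 < p)%N) (e_gt0 : 0 < e).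
Hypothesis e'_ge : e * (1 + 2 * `|ck| / p%:R) <= e'.

Lemma exponent_leq F : (size (sets F))%:R <= ck * (univ_size F)%:R ->
  e * (univ_size (reduce p F) + num_groups p (size (sets F)))%:R <=
  e' * (univ_size F)%:R + e * (p + 4)%:R.
Proof.
set m := size _; set n := univ_size F => mn.
have p0 : 0 < p%:R :> R by rewrite ltr0n.
have mp : (m %/ p)%:R <= `|ck| * n%:R / p%:R.
  rewrite ler_pdivlMr// -natrM (@le_trans _ _ m%:R) ?ler_nat ?leq_divM//.
  by rewrite (le_trans mn)// ler_wpM2r// ler_norm.
have -> : (univ_size (reduce p F) + num_groups p m)%:R =
    n%:R + 2 * (m %/ p)%:R + (p + 4)%:R :> R.
  by rewrite /= /num_cols /num_groups -/m -/n !natrD; ring.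
rewrite mulrDr lerD2r.
apply: (@le_trans _ _ (e * (1 + 2 * `|ck| / p%:R) * n%:R)).
  rewrite -[leRHS]mulrA ler_wpM2l ?(ltW e_gt0)// [leRHS]mulrDl mul1r lerD2l.
  have -> : 2 * `|ck| / p%:R * n%:R = 2 * (`|ck| * n%:R / p%:R) by ring.
  by rewrite ler_wpM2l.
by rewrite ler_wpM2r.
Qed.

Lemma decides_sparse A (q : {poly nat}) :
  (forall x : parity_set_cover (k * p + p + 1), legal x ->
    decides_within A x
      (2 `^ (e * (univ_size x.1 + x.2)%:R) * (q.[input_size x])%:R)) ->
  exists q' : {poly nat}, forall x : sparse_parity_set_cover k ck, legal x ->
    decides_within (sparse_cmd p A) x
      (2 `^ (e' * (univ_size x)%:R) * (q'.[input_size x])%:R).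
Proof.
move=> HA.
have [K hK] : exists K : nat, 2 `^ (e * (p + 4)%:R) <= K%:R :> R.
  exists (Num.bound (2 `^ (e * (p + 4)%:R) : R)).
  exact/ltW/archi_boundP/powR_ge0.
pose c1 := cost_weight (Fetch (Const 1)).
pose c2 := cmd_weight (Assign 0 (subE (Const 1) (Fetch (Const 0)))).
pose f x :=
  (c1 * x + c2 * x + cmd_weight (reduce_cmd p) * time_bound p x + 1)%N.
have [q' hq'] : poly_bounded (fun x => f x + K * q.[size_bound p x])%N.
  apply: poly_bounded_add.
    rewrite /f; poly_bounded_tac; exact: poly_bounded_time.
  by apply: poly_bounded_mul; [exact: poly_bounded_const|
    exact/poly_bounded_horner/poly_bounded_size].
exists q' => F [Fk mn]; set N := input_size F; set n := univ_size F in mn *.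
have e'0 : 0 <= e'.
  apply: le_trans e'_ge.
  by rewrite mulr_ge0 ?(ltW e_gt0)// addr_ge0 ?divr_ge0 ?mulr_ge0.
have P1 : 1 <= 2 `^ (e' * n%:R) :> R.
  by rewrite -[leLHS](powRr0 2) ler_powR ?mulr_ge0// ler1n.
have bF : bounded (init (sparse_word F)) N by exact: bounded_init.
have cost1 := expr_cost_le (Fetch (Const 1)) bF.
have [m0|m_gt0] := posnP (size (sets F)).
  exists 0%N, (fun=> answer F); split; last first.
    rewrite (_ : [set _ | _] = finset.set0) ?finset.cards0 ?mul0r ?divr_ge0//.
    by apply/setP => r; rewrite !inE eqxx.
  move=> r; have [t et lt] :=
    @runs_assign _ _ 0 (subE (Const 1) (Fetch (Const 0))) _ bF (erefl _) r.
  exists (expr_cost (init (sparse_word F)) (Fetch (Const 1)) + t).+1; split.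
    exists (set_reg (init (sparse_word F)) 0 (1 - univ_size F)%N), r; split.
      apply: (@ExecIf _ _ _ (init (sparse_word F))).
      by rewrite /= m0; exact: et.
    by rewrite /= covers_nil; [case: (univ_size F)|exact/size0nil].
  rewrite -[leLHS]mul1r ler_pM// ler_nat (leq_trans _ (hq' N))//.
  rewrite (@leq_trans (f N))// ?leq_addr// /f addn1 ltnS.
  by rewrite (leq_trans (leq_add cost1 lt))// leq_addr.
have n_gt0 : (0 < n)%N.
  rewrite lt0n; apply/negP => /eqP n0; move: mn.
  have -> : n%:R = 0 :> R by rewrite n0.
  by rewrite mulr0 lern0 -leqn0 leqNgt m_gt0.
have [sN] : (size (sparse_word F) <= N)%N by exact: size_leq_bitlen.
rewrite /= size_incidence in sN.
have nN : (n <= N)%N by have := leq_pmull n m_gt0; lia.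
have mN : (size (sets F) <= N)%N.
  by have := leq_pmulr (size (sets F)) n_gt0; lia.
pose x : parity_set_cover (k * p + p + 1) :=
  (reduce p F, num_groups p (size (sets F))).
have encx : encoding x = parity_word p F by rewrite /= size_reduced.
have [l [out [run err]]] : decides_within A x
    (2 `^ (e * (univ_size x.1 + x.2)%:R) * (q.[input_size x])%:R).
  by apply: HA; apply: reduced_bounded => i; exact: count_incident.
exists l, out; split; last first.
  by rewrite -[answer F]/(odd _) -(card_covers_reduce F p_gt0).
move=> r; have [t [[s' [r' [ex res]]] tT]] := run r.
have [t1 et1 lt1] := reduce_runs F p_gt0 (r : seq bool).
pose u := expr_cost (init (sparse_word F)) (Fetch (Const 1)).
exists (u + (t1 + t)).+1; split.
  exists s', r'; split => //; apply: (@ExecIf _ _ _ (init (sparse_word F))).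
  rewrite /= -lt0n m_gt0.
  by apply: (ExecSeq et1); rewrite -encx.
have t1f : ((u + t1).+1 <= f N)%N.
  rewrite /f addn1 ltnS; apply: leq_add.
    by rewrite (leq_trans cost1)// leq_addr.
  by rewrite (leq_trans lt1)// leq_mul2l reduce_time_leq ?orbT.
have tb : t%:R <= 2 `^ (e' * n%:R) * (K * q.[size_bound p N])%:R :> R.
  apply: (le_trans tT); rewrite natrM mulrA ler_pM ?powR_ge0//.
    rewrite (@le_trans _ _ (2 `^ (e' * n%:R + e * (p + 4)%:R)))//.
      by rewrite ler_powR ?ler1n// exponent_leq.
    by rewrite powRD ?pnatr_eq0 ?implybT// ler_wpM2l ?powR_ge0.
  by rewrite ler_nat leq_horner// /input_size encx parity_size_leq.
rewrite addnA -addSn natrD.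
apply: (@le_trans _ _ (2 `^ (e' * n%:R) * (f N + K * q.[size_bound p N])%:R)).
  rewrite natrD mulrDr lerD// -[leLHS]mul1r ler_pM// ler_nat//.
by rewrite ler_wpM2l ?powR_ge0// ler_nat hq'.
Qed.

End Reduction.

(** * Exponents *)

Section Limits.
Variable R : realType.
Local Open Scope classical_set_scope.
Local Open Scope ereal_scope.

Lemma sigma_parity_ge0 k : 0 <= sigma_parity R k.
Proof. by apply: le_ereal_inf_tmp => _ [e [e0 _] <-]; rewrite lee_fin ltW. Qed.

Lemma sigma_parity_nondecreasing :
  {homo (@sigma_parity R) : k l / (k <= l)%N >-> k <= l}.
Proof.
move=> k l kl; apply: ereal_inf_le_tmp => _ [e [e0 [A [q h]]] <-].
exists e => //; split=> //; exists A, q => x xk; apply: (h x) => X XF.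
by rewrite (leq_trans (xk X XF)).
Qed.

Lemma sigma_parity_le_limn k : sigma_parity R k <= limn (@sigma_parity R).
Proof.
rewrite (cvg_lim _ (ereal_nondecreasing_cvgn sigma_parity_nondecreasing))//.
by apply: ereal_sup_ubound; exists k.
Qed.

Lemma sigma_sparse_le_limn (c : nat -> R) k :
  sigma_sparse c k <= limn (@sigma_parity R).
Proof.
have := sigma_parity_le_limn.
case: (limn _) => [r| |] leL; last 2 first.
- by rewrite leey.
- by have := le_trans (sigma_parity_ge0 0%N) (leL 0%N).
have r0 : (0 <= r)%R.
  by have := le_trans (sigma_parity_ge0 0%N) (leL 0%N); rewrite lee_fin.
apply/lee_addgt0Pr => d d0.
have [p p0 pd] : exists2 p, (0 < p)%N &
    ((r + d / 2) * (2 * `|c k| / p%:R) <= d / 2)%R.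
  pose x := ((r + d / 2) * (2 * `|c k|) / (d / 2))%R.
  have x0 : (0 <= x)%R.
    by rewrite /x divr_ge0 ?mulr_ge0 ?addr_ge0 ?divr_ge0 ?(ltW d0).
  exists (Num.bound x).+1 => //.
  rewrite mulrA ler_pdivrMr ?ltr0n// [leRHS]mulrC -ler_pdivrMr ?divr_gt0//.
  by apply: le_trans (ltW (archi_boundP x0)) _; rewrite ler_nat.
have : sigma_parity R (k * p + p + 1)%N < (r + d / 2)%:E.
  by rewrite (le_lt_trans (leL _))// lte_fin ltrDl divr_gt0.
move=> /ereal_inf_lt[_ [e [e0 [A [q hA]]] <-]]; rewrite lte_fin => er.
apply: ereal_inf_lbound; exists (r + d)%R => //; split.
  by rewrite ltr_wpDl.
exists (sparse_cmd p A); apply: (decides_sparse p0 e0 _ hA).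
have y0 : (0 <= 1 + 2 * `|c k| / p%:R :> R)%R.
  by rewrite addr_ge0 ?divr_ge0 ?mulr_ge0.
rewrite (le_trans (ler_wpM2r y0 (ltW er)))// mulrDr mulr1.
by lra.
Qed.

End Limits.

Local Open Scope ring_scope.
Local Open Scope classical_set_scope.
Local Open Scope ereal_scope.

Theorem theorem19 (R : realType) (c : nat -> R) :
  [/\ cvgn (@sigma_parity R),
      limn_esup (sigma_sparse c) <= limn (@sigma_parity R) &
      cvgn (sigma_sparse c) ->
      limn (sigma_sparse c) <= limn (@sigma_parity R)].
Proof.
have esup_le : limn_esup (sigma_sparse c) <= limn (@sigma_parity R).
  rewrite limn_esup_lim; apply: lime_le; first exact: is_cvg_esups.
  apply: nearW => n; apply: ge_ereal_sup => _ [k _ <-].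
  exact: sigma_sparse_le_limn.
split => //; last by move=> /is_cvg_limn_esupE <-.
exact: ereal_nondecreasing_is_cvgn (@sigma_parity_nondecreasing R).
Qed.
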